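(* Let $S \subseteq \mathbb{Z}^n$ be an integrally convex set admitting a dec-min element (i.e., $\mathrm{decmin}(S) \neq \emptyset$). Then there exist a face $F$ of the convex hull $\overline{S}$ and integer vectors $z, z' \in \mathbb{Z}^n$ satisfying $\mathbf{0} \le z' - z \le \mathbf{1}$ (componentwise) such that $$\mathrm{decmin}(S) = F \cap [z, z']_{\mathbb{Z}}.$$ In particular, $\mathrm{decmin}(S)$ is an integrally convex set.
   Context: For $x \in \mathbb{R}^n$, let $x{\downarrow}$ denote the vector obtained from $x$ by rearranging its components in descending order, with $i$th component $x{\downarrow}_i$. For $x, y \in \mathbb{R}^n$, write $x <_{\rm dec} y$ if $x{\downarrow} \neq y{\downarrow}$ and $x{\downarrow}_i < y{\downarrow}_i$ for the smallest $i$ with $x{\downarrow}_i \neq y{\downarrow}_i$; write $x \le_{\rm dec} y$ if $x{\downarrow} = y{\downarrow}$ or $x <_{\rm dec} y$. An element $x$ of a set $S$ of vectors is decreasingly minimal (dec-min) in $S$ if $x \le_{\rm dec} y$ for all $y \in S$. The set of all dec-min elements of $S$ is denoted $\mathrm{decmin}(S)$. For $x \in \mathbb{R}^n$, the integral neighborhood of $x$ is ${\rm N}(x) = \{ z \in \mathbb{Z}^n \mid |x_i - z_i| < 1 \ (i=1,\ldots,n)\}$. The convex hull of a set $T$ is denoted $\overline{T}$. A nonempty set $S \subseteq \mathbb{Z}^n$ is integrally convex if $\overline{S} = \bigcup_{x \in \mathbb{R}^n} \overline{S \cap {\rm N}(x)}$; equivalently, for every $x \in \mathbb{R}^n$, $x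 \in \overline{S}$ implies $x \in \overline{S \cap {\rm N}(x)}$. A face of $\overline{S}$ is the set of minimizers over $\overline{S}$ of a linear function $y \mapsto \langle p, y\rangle = \sum_{i=1}^n p_i y_i$ with some $p \in \mathbb{R}^n$ ($p = \mathbf{0}$ allowed). For $z \le z'$ in $\mathbb{Z}^n$, $[z, z']_{\mathbb{Z}} = \{ x \in \mathbb{Z}^n \mid z_i \le x_i \le z'_i \ (i=1,\ldots,n)\}$. $\mathbf{0}$ and $\mathbf{1}$ are the all-zero and all-one vectors. *)

(* Defs.v *)
From mathcomp Require Import all_boot all_order all_algebra.
From mathcomp Require Import all_classical all_reals all_analysis.

Set Implicit Arguments.
Unset Strict Implicit.
Unset Printing Implicit Defensive.

Import Order.TTheory GRing.Theory Num.Theory.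

Local Open Scope classical_set_scope.
Local Open Scope ring_scope.

(* Z^n is treated as a subset of R^n, R^n being 'rV[R]_n. *)
Definition Zn (R : realType) (n : nat) : set 'rV[R]_n :=
  [set x | x \is a mxOver Num.int].

Definition sort_desc (R : realType) (n : nat) (x : 'rV[R]_n) : 'rV[R]_n :=
  \row_(i < n) (sort (fun a b => b <= a) [seq x 0 j | j <- enum 'I_n])`_i.

(* The witness i is necessarily the smallest index at which the two
   rearrangements differ. *)
Definition dec_lt (R : realType) (n : nat) (x y : 'rV[R]_n) : Prop :=
  exists i : 'I_n,
    (forall j : 'I_n, (j < i)%N -> sort_desc x 0 j = sort_desc y 0 j) /\
    sort_desc x 0 i < sort_desc y 0 i.

Definition dec_le (R : realType) (n : nat) (x y : 'rV[R]_n) : Prop :=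
  sort_desc x = sort_desc y \/ dec_lt x y.

Definition decmin (R : realType) (n : nat) (S : set 'rV[R]_n) :
    set 'rV[R]_n :=
  [set x | S x /\ forall y, S y -> dec_le x y].

Definition int_nbhd (R : realType) (n : nat) (x : 'rV[R]_n) : set 'rV[R]_n :=
  [set z | Zn z /\ forall i, `|x 0 i - z 0 i| < 1].

Definition conv_hull (R : realType) (n : nat) (T : set 'rV[R]_n) :
    set 'rV[R]_n :=
  smallest (@convex_set R 'rV[R]_n) T.

Definition integrally_convex (R : realType) (n : nat) (S : set 'rV[R]_n) :
    Prop :=
  [/\ S !=set0, S `<=` @Zn R n &
      conv_hull S = \bigcup_(x in setT) conv_hull (S `&` int_nbhd x)].

Definition dotv (R : realType) (n : nat) (p y : 'rV[R]_n) : R :=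
  \sum_(i < n) p 0 i * y 0 i.

(* If p is unbounded below on P, or its infimum is not attained, this
   set of minimizers is empty. *)
Definition is_face (R : realType) (n : nat) (P F : set 'rV[R]_n) : Prop :=
  exists p : 'rV[R]_n,
    F = [set x | P x /\ forall y, P y -> dotv p x <= dotv p y].

Definition int_box (R : realType) (n : nat) (z z' : 'rV[R]_n) :
    set 'rV[R]_n :=
  [set x | Zn x /\ forall i, z 0 i <= x 0 i <= z' 0 i].

(* Main.v *)
(* Put M = n + 2. On integer vectors the decreasing preorder is the order of
   the values of Phi(x) = sum_i M^(x_i), so decmin(S) is the set of minimizers
   over S of a separable sum whose summands are strictly convex on Z.

   For u in the convex hull of S, integral convexity puts u in the hull of
   S /\ N(u), where Phi agrees with an affine function L_u; hence the piecewise
   linear interpolation L_u(u) of Phi is at least min Phi on the whole hull.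
   At the midpoint of two minimizers this forces their entries to differ by at
   most 1, and at a point of the hull of decmin(S) it forces every contributing
   point of S /\ N(u) to be a minimizer, so decmin(S) is integrally convex.

   At a minimizer x, the same bound says that the directional derivative
   v |-> sum_i max(a_i v_i, b_i v_i) of the interpolation is nonnegative on the
   cone of feasible directions, where a_i and b_i are the left and right unit
   differences of M^t at x_i. Separation yields p with a_i <= p_i <= b_i that is
   nonnegative on the cone; p defines the face, and the box is spanned by the
   entries of the minimizers. *)
Require Import Defs.
From mathcomp Require Import all_boot all_order all_algebra.
From mathcomp Require Import all_classical all_reals all_analysis.
From mathcomp Require Import ring lra zify.
Set Implicit Arguments.
Unset Strict Implicit.
Unset Printing Implicit Defensive.

Import Order.TTheory GRing.Theory Num.Theory.
Local Open Scope classical_set_scope.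
Local Open Scope ring_scope.

(** * Convex hulls and the pointwise form of integral convexity *)

Lemma convex_setP (R : realType) (n : nat) (A : set 'rV[R]_n) :
  (forall x y a, A x -> A y -> 0 < a < 1 -> A (a *: x + (1 - a) *: y)) <->
  convex_set A.
Proof.
split=> [cA|cA x y a Ax Ay /andP[a0 a1]].
  apply/convex_setW => x y /set_mem Ax /set_mem Ay k k0 k1; apply/mem_set.
  by apply: cA => //; rewrite k0 k1.
have a01 : Itv.spec (@Itv.num_sem R) (Itv.Real `[0%Z, 1%Z]) a.
  by apply/andP; split; [exact: gtr0_real|rewrite /= in_itv/= !ltW].
exact/set_mem/(cA x y (Itv.mk a01))/mem_set/Ay/mem_set.
Qed.

Lemma conv_hull_convex (R : realType) (n : nat) (T : set 'rV[R]_n) x y a :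
  conv_hull T x -> conv_hull T y -> 0 < a < 1 ->
  conv_hull T (a *: x + (1 - a) *: y).
Proof.
move=> Tx Ty a01 A [cA TA].
by move/convex_setP: (cA); apply => //; [exact: Tx|exact: Ty].
Qed.

Lemma conv_hull_sub (R : realType) (n : nat) (T A : set 'rV[R]_n) :
  (forall x y a, A x -> A y -> 0 < a < 1 -> A (a *: x + (1 - a) *: y)) ->
  T `<=` A -> conv_hull T `<=` A.
Proof. by move=> /convex_setP cA; exact: smallest_sub. Qed.

Lemma sub_conv_hull (R : realType) (n : nat) (T : set 'rV[R]_n) :
  T `<=` conv_hull T.
Proof. exact: sub_gen_smallest. Qed.

Lemma conv_hullS (R : realType) (n : nat) (T U : set 'rV[R]_n) :
  T `<=` U -> conv_hull T `<=` conv_hull U.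
Proof.
move=> TU; apply: conv_hull_sub; first exact: conv_hull_convex.
exact: subset_trans TU (@sub_conv_hull _ _ _).
Qed.

Lemma int_lerD1 (R : realType) (x y : R) :
  x \is a Num.int -> y \is a Num.int -> (x + 1 <= y) = (x < y).
Proof. by move=> /intrP[i ->] /intrP[j ->]; rewrite -intrD1 ler_int ltr_int lezD1. Qed.

(** The set [A] below is convex: a point of [T] whose entries are less than 1 away from those of [u]
    is at most 1 away from [v], hence less than 1 away from every proper convex combination of [u]
    and [v]. This turns the union in the definition of integral convexity into a pointwise
    condition. *)
Lemma conv_hull_int_nbhd (R : realType) (n : nat) (S : set 'rV[R]_n) x :
  conv_hull (S `&` int_nbhd x) `<=` [set u | conv_hull (S `&` int_nbhd u) u].
Proof.
set T := S `&` int_nbhd x.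
pose A := [set u : 'rV[R]_n | (forall z, T z -> forall i, `|u 0 i - z 0 i| <= 1) /\
  conv_hull (T `&` int_nbhd u) u].
apply: (@subset_trans _ A); last first.
  by move=> u [_]; apply: conv_hullS => z [[Sz _] zu].
apply: conv_hull_sub => [u v a [u1 Tu] [v1 Tv] a01|u [Su [uZ ux]]].
  have [a0 a1] : 0 < a /\ 0 < 1 - a by case/andP: a01; lra.
  have dist (z : 'rV[R]_n) i : a * `|u 0 i - z 0 i| + (1 - a) * `|v 0 i - z 0 i| >=
      `|(a *: u + (1 - a) *: v) 0 i - z 0 i|.
    rewrite !mxE; apply: le_trans (_ : `|a * (u 0 i - z 0 i)| +
        `|(1 - a) * (v 0 i - z 0 i)| <= _); last first.
      by rewrite !normrM (gtr0_norm a0) (gtr0_norm a1).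
    by apply: le_trans (ler_normD _ _); rewrite le_eqVlt; apply/orP; left; apply/eqP; congr `|_|; ring.
  split=> [z Tz i|].
    apply: le_trans (dist z i) _.
    by have := u1 z Tz i; have := v1 z Tz i; nra.
  apply: conv_hull_convex => //.
    apply: conv_hullS Tu => z [Tz [zZ zu]]; split=> //; split=> // i.
    apply: le_lt_trans (dist z i) _.
    by have := zu i; have := v1 z Tz i; nra.
  apply: conv_hullS Tv => z [Tz [zZ zv]]; split=> //; split=> // i.
  apply: le_lt_trans (dist z i) _.
  by have := zv i; have := u1 z Tz i; nra.
split=> [z [Sz [zZ zx]] i|].
  have ui : u 0 i \is a Num.int by move/mxOverP: uZ.
  have zi : z 0 i \is a Num.int by move/mxOverP: zZ.
  have := ux i; have := zx i; rewrite !ltr_norml ler_norml => /andP[h1 h2] /andP[h3 h4].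
  (* Both entries are integers less than 1 away from the same real, so they differ by less than 2,
     hence by at most 1. *)
  have : u 0 i + 1 <= z 0 i + 1 + 1 by rewrite int_lerD1 ?rpredD ?rpred1//; lra.
  have : z 0 i + 1 <= u 0 i + 1 + 1 by rewrite int_lerD1 ?rpredD ?rpred1//; lra.
  lra.
apply: sub_conv_hull; split; first by split.
by split=> // i; rewrite subrr normr0.
Qed.

Lemma integrally_convexE (R : realType) (n : nat) (S : set 'rV[R]_n) :
  integrally_convex S <->
  [/\ S !=set0, S `<=` @Zn R n &
      forall x, conv_hull S x -> conv_hull (S `&` int_nbhd x) x].
Proof.
split=> -[S0 SZ h]; split=> //.
  by move=> x; rewrite h => -[u _]; exact: conv_hull_int_nbhd.
apply/seteqP; split=> [x Sx|x [u _]]; first by exists x => //; exact: h.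
by apply: conv_hullS; exact: subIsetl.
Qed.

(** * Separable convex sums, their interpolation and their minimizers *)

Definition chord (R : realType) (f : R -> R) (k t : R) : R :=
  f k + (t - k) * (f (k + 1) - f k).

(** On the integers, [f] lies above each of its unit secants and meets it only at the two nodes.
    Keeping the equality case in the inequality lets it be summed over coordinates. *)
Definition strictly_convexZ (R : realType) (f : R -> R) : Prop :=
  forall k t, k \is a Num.int -> t \is a Num.int ->
    chord f k t <= f t ?= iff ((t == k) || (t == k + 1)).

Definition sepsum (R : realType) (n : nat) (f : R -> R) (x : 'rV[R]_n) : R :=
  \sum_(i < n) f (x 0 i).

Definition sepsum_argmin (R : realType) (n : nat) (f : R -> R)
    (S : set 'rV[R]_n) : set 'rV[R]_n :=
  [set x | S x /\ forall y, S y -> sepsum f x <= sepsum f y].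

(* The affine function of [x] that extends, from the unit cell containing [u],
   the separable piecewise linear interpolation of [f]. *)
Definition cell_affine (R : realType) (n : nat) (f : R -> R)
    (u x : 'rV[R]_n) : R :=
  \sum_(i < n) chord f (Num.floor (u 0 i))%:~R (x 0 i).

Lemma chordl (R : realType) (f : R -> R) k : chord f k k = f k.
Proof. by rewrite /chord; ring. Qed.

Lemma chordr (R : realType) (f : R -> R) k : chord f k (k + 1) = f (k + 1).
Proof. by rewrite /chord; ring. Qed.

Lemma cell_affineE (R : realType) (n : nat) (f : R -> R) (u x y : 'rV[R]_n) a :
  cell_affine f u (a *: x + (1 - a) *: y) =
  a * cell_affine f u x + (1 - a) * cell_affine f u y.
Proof.
rewrite /cell_affine !mulr_sumr -big_split; apply: eq_bigr => i _ /=.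
by rewrite /chord !mxE; ring.
Qed.

Lemma cell_affine_leif (R : realType) (n : nat) (f : R -> R)
    (u x : 'rV[R]_n) : strictly_convexZ f -> Zn x ->
  cell_affine f u x <= sepsum f x ?= iff
    [forall i, (x 0 i == (Num.floor (u 0 i))%:~R) ||
               (x 0 i == (Num.floor (u 0 i))%:~R + 1)].
Proof.
move=> fc /mxOverP xZ; apply: leif_sum => i _.
by apply: fc => //; apply/intrP; exists (Num.floor (u 0 i)).
Qed.

Lemma int_nbhd_floor (R : realType) (n : nat) (u z : 'rV[R]_n) i :
  int_nbhd u z ->
  (z 0 i == (Num.floor (u 0 i))%:~R) || (z 0 i == (Num.floor (u 0 i))%:~R + 1).
Proof.
move=> [/mxOverP zZ /(_ i)]; have := floor_itv (u 0 i).
move/intrP: (zZ 0 i) => [k ->]; move: (Num.floor _) => m.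
rewrite ltr_norml => /andP[h1 h2] /andP[h3 h4].
have : (m%:~R < k%:~R + 1 :> R) by lra.
have : (k%:~R < (m + 1)%:~R + 1 :> R) by lra.
rewrite -!intrD1 !ltr_int !eqr_int; lia.
Qed.

Lemma cell_affine_int_nbhd (R : realType) (n : nat) (f : R -> R)
    (u z : 'rV[R]_n) : int_nbhd u z -> cell_affine f u z = sepsum f z.
Proof.
move=> uz; apply: eq_bigr => i _.
by case/orP: (int_nbhd_floor i uz) => /eqP->; rewrite ?chordl ?chordr.
Qed.

Lemma cell_affine_le (R : realType) (n : nat) (f : R -> R) (u x : 'rV[R]_n) :
  strictly_convexZ f -> Zn x -> cell_affine f u x <= sepsum f x.
Proof. by move=> fc /(cell_affine_leif u fc)/leifP; case: ifP => _ => [/eqP->|/ltW]. Qed.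

(** The bound holds on the points of [S] near [u], where the affine function equals [sepsum f], and
    passes to their hull, which contains [u]. *)
Lemma conv_hull_ge_min (R : realType) (n : nat) (f : R -> R)
    (S : set 'rV[R]_n) m u :
  integrally_convex S -> (forall z, S z -> m <= sepsum f z) ->
  conv_hull S u -> m <= cell_affine f u u.
Proof.
move=> /integrally_convexE[_ _ icS] fm /icS.
suff : conv_hull (S `&` int_nbhd u) `<=` [set v | m <= cell_affine f u v] by apply.
apply: conv_hull_sub => [x y a /= mx my /andP[a0 a1]|z [Sz uz] /=].
  by rewrite cell_affineE; nra.
by rewrite (cell_affine_int_nbhd f uz) fm.
Qed.

(** At the midpoint [u], the average of the affine minorant over [x] and [y] is at least the
    minimum, so the minorant is tight at both; by the equality case, [x] and [y] are vertices of one
    unit cell. *)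
Lemma sepsum_argmin_dist (R : realType) (n : nat) (f : R -> R)
    (S : set 'rV[R]_n) (x y : 'rV[R]_n) (i : 'I_n) :
  strictly_convexZ f -> integrally_convex S ->
  sepsum_argmin f S x -> sepsum_argmin f S y -> `|x 0 i - y 0 i| <= 1.
Proof.
move=> fc icS [Sx xm] [Sy ym]; have [_ SZ _] := icS.
have h01 : 0 < (2^-1 : R) < 1 by lra.
pose u := 2^-1 *: x + (1 - 2^-1) *: y.
have Su : conv_hull S u by apply: conv_hull_convex => //; exact: sub_conv_hull.
have xy : sepsum f x = sepsum f y by apply/le_anti; rewrite xm ?ym.
have := conv_hull_ge_min icS xm Su; rewrite {2}/u cell_affineE => h.
have hx := cell_affine_leif u fc (SZ _ Sx); have hy := cell_affine_leif u fc (SZ _ Sy).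
have lx := cell_affine_le u fc (SZ _ Sx); have ly := cell_affine_le u fc (SZ _ Sy).
have /eqP : cell_affine f u x = sepsum f x by lra.
have /eqP : cell_affine f u y = sepsum f y by lra.
rewrite hx hy => /forallP/(_ i)/orP yi /forallP/(_ i)/orP xi.
by case: xi yi => [] /eqP-> [] /eqP->; rewrite ler_norml; lra.
Qed.

(* An affine function attaining its minimum over the hull of [T] at [u] is
   minimal at every point of [T] that contributes to [u]. *)
Lemma conv_hull_argmin (R : realType) (n : nat) (l : 'rV[R]_n -> R)
    (T : set 'rV[R]_n) m :
  (forall x y a, l (a *: x + (1 - a) *: y) = a * l x + (1 - a) * l y) ->
  (forall z, T z -> m <= l z) ->
  forall u, conv_hull T u -> l u <= m -> conv_hull [set z | T z /\ l z = m] u.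
Proof.
move=> ll lm u Tu lu.
(* Carrying the bound [m <= l u] makes this set convex: if a proper combination has value [m], so do
   both of its ends. *)
pose A := [set u | m <= l u /\ (l u = m -> conv_hull [set z | T z /\ l z = m] u)].
suff /(_ u Tu)[mu] : conv_hull T `<=` A by apply; apply/le_anti; rewrite lu.
apply: conv_hull_sub => [x y a [mx hx] [my hy] a01|z Tz].
  have /andP[a0 a1] := a01.
  split=> [|]; rewrite ll; first by nra.
  move=> e; apply: conv_hull_convex => //; [apply: hx|apply: hy]; nra.
by split=> [|e]; [exact: lm|apply: sub_conv_hull].
Qed.

Lemma integrally_convex_sepsum_argmin (R : realType) (n : nat) (f : R -> R)
    (S : set 'rV[R]_n) :
  strictly_convexZ f -> integrally_convex S -> sepsum_argmin f S !=set0 ->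
  integrally_convex (sepsum_argmin f S).
Proof.
move=> fc /[dup] icS /integrally_convexE[_ SZ icSE] [x0 x0D].
have [Sx0 x0m] := x0D.
apply/integrally_convexE; split; [by exists x0|by move=> x [/SZ]|].
move=> x Dx; have Sx : conv_hull S x by apply: conv_hullS Dx => y [].
have /icSE := Sx => Tx.
(* The affine function is at most the minimum at every minimizer, hence on their hull. *)
have lx : cell_affine f x x <= sepsum f x0.
  suff : conv_hull (sepsum_argmin f S) `<=`
         [set v | cell_affine f x v <= sepsum f x0] by apply.
  apply: conv_hull_sub => [u v a /= hu hv /andP[a0 a1]|z [Sz zm] /=].
    by rewrite cell_affineE; nra.
  by apply: le_trans (cell_affine_le x fc (SZ _ Sz)) _; exact: zm.
have := conv_hull_argmin (@cell_affineE R n f x) _ Tx lx.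
have h z : (S `&` int_nbhd x) z -> sepsum f x0 <= cell_affine f x z.
  by move=> [Sz xz]; rewrite (cell_affine_int_nbhd f xz) x0m.
move/(_ h); apply: conv_hullS => z [[Sz xz]].
rewrite (cell_affine_int_nbhd f xz) => e; split=> //; split=> // y Sy.
by rewrite e x0m.
Qed.

(** * Separation of a convex cone by a vector of a box *)

(** For [a <= b] this is the support function of the box: the maximum of [dotv p v] over all [p]
    between [a] and [b]. *)
Definition box_support (R : realType) (n : nat) (a b : 'I_n -> R)
    (v : 'rV[R]_n) : R :=
  \sum_(i < n) Num.max (a i * v 0 i) (b i * v 0 i).

Lemma ler_maxD (R : realType) (a b u v s t : R) : 0 < s -> 0 < t ->
  Num.max (a * (s * u + t * v)) (b * (s * u + t * v)) <=
  s * Num.max (a * u) (b * u) + t * Num.max (a * v) (b * v).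
Proof.
move=> s0 t0; have au : a * u <= Num.max (a * u) (b * u) by rewrite le_max lexx.
have bu : b * u <= Num.max (a * u) (b * u) by rewrite le_max lexx orbT.
have av : a * v <= Num.max (a * v) (b * v) by rewrite le_max lexx.
have bv : b * v <= Num.max (a * v) (b * v) by rewrite le_max lexx orbT.
by rewrite ge_max; apply/andP; split; nra.
Qed.

(** The one-dimensional step of Hahn-Banach: vectors with positive entry [i] bound [c] from below,
    those with negative entry bound it from above, and sublinearity of the remaining sum [h] makes
    the bounds compatible. *)
Lemma box_support_shrink1 (R : realType) (n : nat) (C : set 'rV[R]_n)
    (a b : 'I_n -> R) (i : 'I_n) :
  (forall u v s t, C u -> C v -> 0 < s -> 0 < t -> C (s *: u + t *: v)) ->
  a i <= b i -> (forall v, C v -> 0 <= box_support a b v) ->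
  exists2 c, a i <= c <= b i &
    forall v, C v -> 0 <= box_support (fun j => if j == i then c else a j)
                                      (fun j => if j == i then c else b j) v.
Proof.
move=> CC ab g0.
pose h (v : 'rV[R]_n) := \sum_(j < n | j != i) Num.max (a j * v 0 j) (b j * v 0 j).
have gE v : box_support a b v = Num.max (a i * v 0 i) (b i * v 0 i) + h v.
  by rewrite /box_support (bigD1 i).
have hD u v s t : 0 < s -> 0 < t -> h (s *: u + t *: v) <= s * h u + t * h v.
  move=> s0 t0; rewrite /h !mulr_sumr -big_split; apply: ler_sum => j _ /=.
  by rewrite !mxE; exact: ler_maxD.
(* Including [a i] keeps [E] nonempty when no vector has a positive entry [i], and gives
   [a i <= sup E]. *)
pose E := [set a i] `|` [set - h v / v 0 i | v in [set v | C v /\ 0 < v 0 i]].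
have Eb : ubound E (b i).
  move=> _ [->//|[v [Cv v0] <-]]; rewrite ler_pdivrMr//.
  by have := g0 v Cv; rewrite gE max_r ?ler_pM2r//; lra.
have Ea : E (a i) by left.
have hE : has_ubound E by exists (b i).
exists (sup E) => [|v Cv].
  by rewrite (ub_le_sup hE Ea) ge_sup//; exists (a i).
rewrite /box_support (bigD1 i)//= eqxx maxxx.
rewrite (eq_bigr (fun j => Num.max (a j * v 0 j) (b j * v 0 j))); last first.
  by move=> j /negPf ->.
rewrite -/(h v); have [v0|v0|v0] := ltgtP (v 0 i) 0.
- suff : sup E <= h v / - v 0 i.
    by rewrite ler_pdivlMr ?oppr_gt0//; lra.
  apply: ge_sup; first by exists (a i).
  move=> _ [->|[w [Cw w0] <-]].
    rewrite ler_pdivlMr ?oppr_gt0//.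
    by have := g0 v Cv; rewrite gE max_l ?ler_nM2r//; lra.
  rewrite ler_pdivlMr ?oppr_gt0// mulrAC ler_pdivrMr//.
  have nv0 : 0 < - v 0 i by rewrite oppr_gt0.
  (* With these weights entry [i] cancels, so only [h] remains. *)
  have := g0 _ (CC _ _ _ _ Cw Cv nv0 w0); rewrite gE !mxE.
  rewrite (_ : - v 0 i * w 0 i + w 0 i * v 0 i = 0); last by ring.
  rewrite !mulr0 maxxx add0r => /le_trans/(_ (hD _ _ _ _ nv0 w0)); lra.
- have : E (- h v / v 0 i) by right; exists v.
  by move/(ub_le_sup hE); rewrite ler_pdivrMr//; lra.
- by have := g0 v Cv; rewrite gE v0 !mulr0 maxxx.
Qed.

(* Hahn-Banach for the support function of a box: the box is shrunk to a
   point one coordinate at a time. *)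
Lemma box_support_separation (R : realType) (n : nat) (C : set 'rV[R]_n)
    (a b : 'I_n -> R) :
  (forall u v s t, C u -> C v -> 0 < s -> 0 < t -> C (s *: u + t *: v)) ->
  (forall i, a i <= b i) -> (forall v, C v -> 0 <= box_support a b v) ->
  exists2 p : 'rV[R]_n, forall i, a i <= p 0 i <= b i &
    forall v, C v -> 0 <= dotv p v.
Proof.
move=> CC ab g0.
have [a' [b' [ab' g' e]]] : exists a' b' : 'I_n -> R,
    [/\ forall i, a i <= a' i /\ a' i <= b' i /\ b' i <= b i,
        forall v, C v -> 0 <= box_support a' b' v &
        forall i, i \in enum 'I_n -> a' i = b' i].
  elim: (enum 'I_n) => [|i s [a' [b' [ab' g' e]]]].
    by exists a, b; split=> // i; split.
  have [aa [ab'i bb]] := ab' i.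
  have [c /andP[ac cb] gc] := box_support_shrink1 CC ab'i g'.
  exists (fun j => if j == i then c else a' j), (fun j => if j == i then c else b' j).
  split=> // j; last by rewrite in_cons; case: eqP => //= _; exact: e.
  by case: eqP => [->|_]; [split; [|split] => //; lra|exact: ab'].
exists (\row_i a' i) => [i|v Cv].
  by have := ab' i; rewrite mxE; lra.
apply: le_trans (g' v Cv) _; rewrite /box_support /dotv; apply: ler_sum => i _.
by rewrite mxE -e ?mem_enum// maxxx.
Qed.

(** * Optimality multiplier at a minimizer, and the face it defines *)

Lemma dotvB (R : realType) (n : nat) (p x y : 'rV[R]_n) :
  dotv p (x - y) = dotv p x - dotv p y.
Proof. by rewrite /dotv -sumrB; apply: eq_bigr => i _; rewrite !mxE mulrBr. Qed.

(** The floor of [k + t] is [k] or [k - 1], so the chord has one of the two slopes in the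
    maximum. *)
Lemma chord_floor_le (R : realType) (f : R -> R) (k t : R) :
  k \is a Num.int -> `|t| < 1 ->
  chord f (Num.floor (k + t))%:~R (k + t) <=
  f k + Num.max ((f k - f (k - 1)) * t) ((f (k + 1) - f k) * t).
Proof.
move=> /intrP[m ->]; rewrite ltr_norml => /andP[t1 t2].
have := floor_itv (m%:~R + t); move: (Num.floor _) => l /andP[h1 h2].
have : (l%:~R < (m + 1)%:~R :> R) by rewrite intrD1; lra.
have : ((m - 1)%:~R < (l + 1)%:~R :> R) by rewrite intrB; move: h2; lra.
rewrite !ltr_int => lm ml.
have [->|->] : l = m \/ l = m - 1 by lia.
  rewrite /chord addrAC subrr add0r mulrC lerD2l le_max lexx orbT //.
rewrite /chord intrB subrK.
have -> : m%:~R + t - (m%:~R - 1) = t + 1 by ring.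
have h : (f m%:~R - f (m%:~R - 1)) * t <=
    Num.max ((f m%:~R - f (m%:~R - 1)) * t) ((f (m%:~R + 1) - f m%:~R) * t).
  by rewrite le_max lexx.
apply: le_trans (_ : _ <= f m%:~R + (f m%:~R - f (m%:~R - 1)) * t) _; last by rewrite lerD2l.
by rewrite le_eqVlt; apply/orP; left; apply/eqP; ring.
Qed.

Lemma int_dist_le1 (R : realType) (x y : R) :
  x \is a Num.int -> y \is a Num.int -> `|x - y| <= 1 ->
  [\/ x = y - 1, x = y | x = y + 1].
Proof.
move=> /intrP[k ->] /intrP[l ->].
rewrite -intrB -intr_norm (ler_int _ _ 1) ler_norml => /andP[h1 h2].
have [->|[->|->]] : k = l - 1 \/ k = l \/ k = l + 1 by lia.
- by constructor 1; rewrite intrB.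
- by constructor 2.
- by constructor 3; rewrite intrD.
Qed.

Lemma sepsum_argmin_multiplier (R : realType) (n : nat) (f : R -> R)
    (S : set 'rV[R]_n) (x : 'rV[R]_n) :
  integrally_convex S -> strictly_convexZ f -> sepsum_argmin f S x ->
  exists2 p : 'rV[R]_n,
    forall i, f (x 0 i) - f (x 0 i - 1) <= p 0 i <= f (x 0 i + 1) - f (x 0 i) &
    forall u, conv_hull S u -> dotv p x <= dotv p u.
Proof.
move=> icS fc [Sx xm]; have [_ SZ _] := icS.
have hSx := sub_conv_hull Sx.
have xZ i : x 0 i \is a Num.int by have /mxOverP := SZ _ Sx.
pose C := [set v : 'rV[R]_n | exists2 t, 0 < t & conv_hull S (x + t *: v)].
have CC u v s t : C u -> C v -> 0 < s -> 0 < t -> C (s *: u + t *: v).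
  move=> [k k0 Su] [l l0 Sv] s0 t0.
  have d0 : 0 < s * l + t * k by rewrite addr_gt0 ?mulr_gt0.
  (* This step length makes the new point a convex combination of [x + k *: u] and [x + l *: v],
     with weights proportional to [s * l] and [t * k]. *)
  exists (k * l / (s * l + t * k)); first by rewrite divr_gt0 ?mulr_gt0.
  have -> : x + (k * l / (s * l + t * k)) *: (s *: u + t *: v) =
      (s * l / (s * l + t * k)) *: (x + k *: u) +
      (1 - s * l / (s * l + t * k)) *: (x + l *: v).
    by apply/rowP => i; rewrite !mxE; field; rewrite gt_eqF.
  apply: conv_hull_convex => //.
  by rewrite divr_gt0 ?mulr_gt0// ltr_pdivrMr// mul1r ltrDl mulr_gt0.
have [p pab p0] : exists2 p : 'rV[R]_n,
    forall i, f (x 0 i) - f (x 0 i - 1) <= p 0 i <= f (x 0 i + 1) - f (x 0 i) &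
    forall v, C v -> 0 <= dotv p v.
  apply: box_support_separation CC _ _ => [i|v [t t0 Sv]].
    have x1 : x 0 i - 1 \is a Num.int by rewrite rpredB ?rpred1.
    have [+ _] := fc _ _ (xZ i) x1; rewrite /chord; lra.
  (* Dividing the step by [N] moves every entry by less than 1; since [N >= 2], the new point lies
     strictly between [x] and [x + t *: v] in parameter, hence in the hull. *)
  pose N := 2 + \sum_j t * `|v 0 j|.
  have N2 : 2 <= N.
    by rewrite lerDl sumr_ge0// => j _; rewrite mulr_ge0// ltW.
  have N0 : 0 < N by lra.
  have N1 : 0 < N^-1 < 1 by rewrite invr_gt0 N0 invf_lt1//; lra.
  have vN i : `|t / N * v 0 i| < 1.
    rewrite !normrM normfV (gtr0_norm t0) (gtr0_norm N0) mulrAC ltr_pdivrMr// mul1r.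
    rewrite /N (bigD1 i)//= addrCA ltrDl.
    by rewrite ltr_pwDl// sumr_ge0// => j _; rewrite mulr_ge0// ltW.
  have SN : conv_hull S (x + (t / N) *: v).
    have -> : x + (t / N) *: v = N^-1 *: (x + t *: v) + (1 - N^-1) *: x.
      by apply/rowP => i; rewrite !mxE; ring.
    exact: conv_hull_convex.
  have := conv_hull_ge_min icS xm SN.
  have : cell_affine f (x + (t / N) *: v) (x + (t / N) *: v) <=
      sepsum f x + t / N * box_support (fun i => f (x 0 i) - f (x 0 i - 1))
                                       (fun i => f (x 0 i + 1) - f (x 0 i)) v.
    rewrite /cell_affine /sepsum /box_support mulr_sumr -big_split.
    apply: ler_sum => i _; rewrite !mxE.
    apply: le_trans (chord_floor_le _ (xZ i) (vN i)) _.
    have tN : 0 <= t / N by rewrite divr_ge0// ltW.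
    by rewrite lerD2l maxr_pMr// !(mulrCA (t / N)).
  move=> h1 h2; have := le_trans h2 h1.
  by rewrite lerDl pmulr_rge0// divr_gt0.
exists p => // u Su; rewrite -subr_ge0 -dotvB; apply: p0.
by exists 1 => //; rewrite scale1r addrC subrK.
Qed.

(** The multiplier [p] gives a linear lower bound on [f] at entries at most 1 away from those of
    [x]. Minimizers are tight for it in each coordinate. Every entry of a box point is the entry of
    some minimizer, so tightness carries over to it, and lying in the face then makes it optimal. *)
Lemma sepsum_argmin_face (R : realType) (n : nat) (f : R -> R)
    (S : set 'rV[R]_n) :
  strictly_convexZ f -> integrally_convex S -> sepsum_argmin f S !=set0 ->
  exists (F : set 'rV[R]_n) (z z' : 'rV[R]_n),
    [/\ is_face (conv_hull S) F, Zn z /\ Zn z',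
        forall i : 'I_n, 0 <= (z' - z) 0 i <= 1 &
        sepsum_argmin f S = F `&` int_box z z'].
Proof.
move=> fc icS [x xD]; have [Sx xm] := xD.
have /integrally_convexE[_ SZ icSE] := icS.
have [p pab pF] := sepsum_argmin_multiplier icS fc xD.
have xZ i : x 0 i \is a Num.int by have /mxOverP := SZ _ Sx.
have DZ w i : sepsum_argmin f S w -> w 0 i \is a Num.int.
  by move=> [/SZ/mxOverP].
have D3 w i : sepsum_argmin f S w ->
    [\/ w 0 i = x 0 i - 1, w 0 i = x 0 i | w 0 i = x 0 i + 1].
  by move=> wD; exact: int_dist_le1 (DZ w i wD) (xZ i) (sepsum_argmin_dist i fc icS wD xD).
have Dp w : sepsum_argmin f S w -> dotv p w = dotv p x /\
    forall i, f (w 0 i) = f (x 0 i) + p 0 i * (w 0 i - x 0 i).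
  move=> wD; have [Sw wm] := wD.
  have le_f i : f (x 0 i) + p 0 i * (w 0 i - x 0 i) <= f (w 0 i).
    by have := pab i; case: (D3 w i wD) => ->; lra.
  have sE : \sum_i (f (x 0 i) + p 0 i * (w 0 i - x 0 i)) =
      sepsum f x + (dotv p w - dotv p x).
    by rewrite big_split -dotvB /dotv; congr (_ + _); apply: eq_bigr => i _; rewrite !mxE.
  have e : dotv p w = dotv p x.
    apply/le_anti; rewrite pF ?andbT; last exact: sub_conv_hull.
    have : \sum_i (f (x 0 i) + p 0 i * (w 0 i - x 0 i)) <= sepsum f w.
      by apply: ler_sum => i _; exact: le_f.
    by have := wm x Sx; rewrite sE; lra.
  split=> // i; apply/eqP; rewrite eq_le le_f andbT leNgt; apply/negP => lt_f.
  have : \sum_i (f (x 0 i) + p 0 i * (w 0 i - x 0 i)) < sepsum f w.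
    rewrite /sepsum (bigD1 i)//= [ltRHS](bigD1 i)//=.
    by apply: ltr_leD => //; apply: ler_sum.
  by have := wm x Sx; rewrite sE e; lra.
(* A coordinate is never both lowered in [z] and raised in [z']: two minimizers would then differ by
   2. *)
pose z := \row_i (if `[< exists2 w, sepsum_argmin f S w & w 0 i = x 0 i - 1 >]
                  then x 0 i - 1 else x 0 i).
pose z' := \row_i (if `[< exists2 w, sepsum_argmin f S w & w 0 i = x 0 i + 1 >]
                   then x 0 i + 1 else x 0 i).
exists [set u | conv_hull S u /\ forall y, conv_hull S y -> dotv p u <= dotv p y], z, z'.
split.
- by exists p.
- by split; apply/mxOverP => i j; rewrite mxE; case: ifP => _;
    rewrite ?rpredB ?rpredD ?rpred1.
- move=> i; rewrite !mxE; case: asboolP => [[w wD wi]|_]; case: asboolP => [[v vD vi]|_]; try lra.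
  have := sepsum_argmin_dist i fc icS wD vD.
  by rewrite wi vi ler_norml; lra.
- apply/seteqP; split=> [w wD|w [[Sw wF] [wZ zw]]].
    have [Sw wm] := wD; split; [split|split].
    + exact: sub_conv_hull.
    + by move=> y Sy; rewrite (Dp w wD).1; exact: pF.
    + exact: SZ.
    + move=> i; rewrite !mxE; case: asboolP => [h1|h1]; case: asboolP => [h2|h2];
        case: (D3 w i wD) => wi; rewrite ?wi; try lra;
        by [case: h1; exists w|case: h2; exists w].
  (* The integral neighborhood of an integer point is that point alone, so an integer point of the
     hull lies in [S]. *)
  have {}Sw : S w.
    suff /(_ w (icSE w Sw))[] : conv_hull (S `&` int_nbhd w) `<=` [set u | u = w /\ S w] by [].
    apply: conv_hull_sub => [u v a [-> ?] [-> _] _|u [Su [uZ uw]]].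
      by split=> //; rewrite -scalerDl addrC subrK scale1r.
    suff -> : w = u by [].
    apply/rowP => i; move: (uw i).
    have /intrP[k ->] : w 0 i \is a Num.int by have /mxOverP := wZ.
    have /intrP[l ->] : u 0 i \is a Num.int by have /mxOverP := uZ.
    by rewrite -intrB -intr_norm (ltr_int _ _ 1) ltr_norml => /andP[h1 h2]; congr intr; lia.
  have coord i : exists2 v, sepsum_argmin f S v & v 0 i = w 0 i.
    have : `|w 0 i - x 0 i| <= 1.
      have /andP[] := zw i; rewrite !mxE ler_norml.
      by case: ifP => _; case: ifP => _; lra.
    have /mxOverP/(_ 0 i) wi := wZ; case/(int_dist_le1 wi (xZ i)) => e.
    - have := zw i; rewrite !mxE => /andP[+ _].
      by case: asboolP => [[v vD ve] _|_]; [exists v; rewrite ?ve|lra].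
    - by exists x.
    - have := zw i; rewrite !mxE => /andP[_].
      by case: asboolP => [[v vD ve] _|_]; [exists v; rewrite ?ve|lra].
  have wE i : f (w 0 i) = f (x 0 i) + p 0 i * (w 0 i - x 0 i).
    by have [v vD <-] := coord i; exact: (Dp v vD).2.
  split=> // y Sy; apply: le_trans (xm y Sy).
  have -> : sepsum f w = sepsum f x + (dotv p w - dotv p x).
    rewrite -dotvB /dotv /sepsum -big_split; apply: eq_bigr => i _.
    by rewrite wE !mxE.
  by have := wF x (sub_conv_hull Sx); lra.
Qed.

(** * Power sums and the decreasing order *)

Lemma bernoulli_leif (R : realType) (M : R) (d : int) : 2 <= M ->
  1 + d%:~R * (M - 1) <= M `^ d%:~R ?= iff ((d == 0) || (d == 1)).
Proof.
move=> M2; have M0 : 0 <= M by lra.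
apply/leifP; case: d => [d|d].
  rewrite -[d%:~R]/(d%:R) powR_mulrn//; case: d => [|[|d]] /=.
  - by rewrite expr0 mul0r addr0.
  - by rewrite expr1 mul1r addrC subrK.
  - elim: d => [|d IH]; first by rewrite expr2; nra.
    rewrite exprS -(natr1 d.+2); have : (1 : R) <= d.+2%:R by rewrite ler1n.
    move: IH; move: (d.+2%:R : R) (M ^+ d.+2) => s t st s1.
    have : 0 < M * (t - (1 + s * (M - 1))) by rewrite mulr_gt0//; lra.
    have : 0 <= s * ((M - 1) * (M - 1)) by rewrite !mulr_ge0//; lra.
    lra.
have -> : (Negz d == 0) || (Negz d == 1) = false by lia.
(* For a negative exponent, [2 <= M] makes the linear side nonpositive. *)
apply: (@le_lt_trans _ _ 0); last by rewrite powR_gt0//; lra.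
rewrite NegzE mulrNz -[d.+1%:~R]/(d.+1%:R).
have : (1 : R) <= d.+1%:R by rewrite ler1n.
nra.
Qed.

Lemma powR_strictly_convexZ (R : realType) (M : R) :
  2 <= M -> strictly_convexZ (powR M).
Proof.
move=> M2 k t /intrP[m ->] /intrP[l ->].
have M0 : 0 < M by lra.
have [d ->] : exists d, l = m + d by exists (l - m); lia.
have [h1 h2] := bernoulli_leif d M2.
have Mm : 0 < M `^ m%:~R by rewrite powR_gt0.
have fE : M `^ (m + d)%:~R = M `^ m%:~R * M `^ d%:~R.
  by rewrite intrD powRD// (gt_eqF M0) implybT.
have chE : chord (powR M) m%:~R (m + d)%:~R =
    M `^ m%:~R * (1 + d%:~R * (M - 1)).
  by rewrite /chord powRD ?(gt_eqF M0) ?implybT// powRr1 ?ltW// intrD; ring.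
split; rewrite chE fE; first by rewrite ler_pM2l.
rewrite (inj_eq (mulfI (lt0r_neq0 Mm))) h2 -intrD1 !eqr_int.
lia.
Qed.

Lemma sepsum_sort_desc (R : realType) (n : nat) (f : R -> R) (x : 'rV[R]_n) :
  sepsum f (sort_desc x) = sepsum f x.
Proof.
rewrite /sepsum; set s := sort (fun a b => b <= a) [seq x 0 j | j <- enum 'I_n].
have sn : size s = n by rewrite size_sort size_map size_enum_ord.
under eq_bigr do rewrite mxE -/s.
have <- : \sum_(t <- s) f t = \sum_(i < n) f s`_i by rewrite (big_nth 0) sn big_mkord.
by rewrite (perm_big _ (permEl (perm_sort _ _))) big_map big_enum.
Qed.

Lemma sort_desc_Zn (R : realType) (n : nat) (x : 'rV[R]_n) :
  Zn x -> Zn (sort_desc x).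
Proof.
move=> /mxOverP xZ; apply/mxOverP => i j; rewrite mxE.
set s := sort _ _; have : s`_j \in s.
  by rewrite mem_nth// size_sort size_map size_enum_ord.
by rewrite mem_sort => /mapP[k _ ->].
Qed.

Lemma sort_desc_antitone (R : realType) (n : nat) (x : 'rV[R]_n) (i j : 'I_n) :
  (i <= j)%N -> sort_desc x 0 j <= sort_desc x 0 i.
Proof.
move=> ij; rewrite !mxE; set s := sort _ _.
have sn : size s = n by rewrite size_sort size_map size_enum_ord.
have tr : transitive (fun a b : R => b <= a) by move=> a b c ba cb; exact: le_trans cb ba.
apply: (sorted_leq_nth tr) => //; rewrite ?inE ?sn//.
by apply: sort_sorted => a b; rewrite orbC le_total.
Qed.

(** After sorting, let [i] be the first differing index. The terms of [x] from [i] on total at most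
    [n] times the one at [i], which is below [M] times it; by integrality this is at most the term
    of [y] at [i]. *)
Lemma dec_lt_sepsum (R : realType) (n : nat) (M : R) (x y : 'rV[R]_n) :
  n%:R < M -> 1 <= M -> Zn x -> Zn y -> dec_lt x y ->
  sepsum (powR M) x < sepsum (powR M) y.
Proof.
move=> nM M1 /sort_desc_Zn/mxOverP xZ /sort_desc_Zn/mxOverP yZ [i [eqxy ltxy]].
have M0 : 0 < M by lra.
rewrite -(sepsum_sort_desc _ x) -(sepsum_sort_desc _ y) /sepsum.
rewrite (bigID (fun j : 'I_n => (j < i)%N)) [ltRHS](bigID (fun j : 'I_n => (j < i)%N))/=.
rewrite (eq_bigr (fun j => M `^ sort_desc y 0 j)); last by move=> j /eqxy ->.
rewrite ltrD2l.
apply: (@le_lt_trans _ _ (n%:R * M `^ sort_desc x 0 i)).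
  apply: (@le_trans _ _ (\sum_(j < n) M `^ sort_desc x 0 i)); last first.
    by rewrite sumr_const card_ord mulr_natl.
  apply: (@le_trans _ _ (\sum_(j < n | ~~ (j < i)%N) M `^ sort_desc x 0 i)).
    by apply: ler_sum => j; rewrite -leqNgt => ij; rewrite ler_powR// sort_desc_antitone.
  rewrite [leRHS](bigID (fun j : 'I_n => (j < i)%N))/= lerDr.
  by apply: sumr_ge0 => j _; exact: powR_ge0.
apply: (@lt_le_trans _ _ (M `^ (sort_desc x 0 i + 1))).
  by rewrite powRD ?(gt_eqF M0) ?implybT// powRr1 ?ltW// mulrC ltr_pM2l ?powR_gt0.
apply: (@le_trans _ _ (M `^ sort_desc y 0 i)); first by rewrite ler_powR// int_lerD1.
rewrite [leRHS](bigD1 i) ?ltnn//= lerDl.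
by apply: sumr_ge0 => j _; exact: powR_ge0.
Qed.

Lemma dec_leVlt (R : realType) (n : nat) (x y : 'rV[R]_n) :
  dec_le x y \/ dec_lt y x.
Proof.
pose P (i : 'I_n) := sort_desc x 0 i != sort_desc y 0 i.
have [/existsP[i0 Pi0]|] := boolP [exists i, P i]; last first.
  rewrite negb_exists => /forallP h; left; left; apply/rowP => i.
  by apply/eqP; move: (h i); rewrite negbK.
have [i Pi imin] := arg_minnP (fun i : 'I_n => i : nat) Pi0.
have eqxy (j : 'I_n) : (j < i)%N -> sort_desc x 0 j = sort_desc y 0 j.
  by move=> ji; apply/eqP; apply: contraTT ji => /imin; rewrite -leqNgt.
have [lt|gt|e] := ltgtP (sort_desc x 0 i) (sort_desc y 0 i).
- by left; right; exists i.
- by right; exists i; split=> // j /eqxy ->.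
- by move: Pi; rewrite /P e eqxx.
Qed.

(** Strict monotonicity of the power sum gives one inclusion; with totality of the preorder it gives
    the other. *)
Lemma decmin_sepsum (R : realType) (n : nat) (M : R) (S : set 'rV[R]_n) :
  n%:R < M -> 1 <= M -> S `<=` @Zn R n ->
  decmin S = sepsum_argmin (powR M) S.
Proof.
move=> nM M1 SZ; apply/seteqP; split=> x [Sx xm]; split=> // y Sy.
  case: (xm y Sy) => [e|/(dec_lt_sepsum nM M1 (SZ _ Sx) (SZ _ Sy))/ltW//].
  by rewrite -(sepsum_sort_desc _ x) e sepsum_sort_desc.
have [//|/(dec_lt_sepsum nM M1 (SZ _ Sy) (SZ _ Sx))] := dec_leVlt x y.
by rewrite ltNge xm.
Qed.

Theorem theorem1p3 (R : realType) (n : nat) (S : set 'rV[R]_n)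
    (S_ic : integrally_convex S) (S_decmin : decmin S !=set0) :
  (exists (F : set 'rV[R]_n) (z z' : 'rV[R]_n),
      [/\ is_face (conv_hull S) F,
          Zn z /\ Zn z',
          forall i : 'I_n, 0 <= (z' - z) 0 i <= 1 &
          decmin S = F `&` int_box z z']) /\
  integrally_convex (decmin S).
Proof.
(* The base must be at least 2 for Bernoulli and exceed [n] for the order comparison; [n + 2] does
   both, even for [n = 0]. *)
have M2 : 2 <= (n.+2%:R : R) by rewrite ler_nat.
have M1 : 1 <= (n.+2%:R : R) by rewrite ler1n.
have nM : n%:R < (n.+2%:R : R) by rewrite ltr_nat.
have fc := powR_strictly_convexZ M2.
have [_ SZ _] := S_ic.
move: S_decmin; rewrite (decmin_sepsum nM M1 SZ) => Dn0.
by split; [exact: sepsum_argmin_face|exact: integrally_convex_sepsum_argmin].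
Qed.
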